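(* Let $\mathcal{A}$ be a just-infinite C*-algebra and let $\alpha:G\to\mathrm{Aut}(\mathcal{A})$ be an action of a finite group $G$ with the Rokhlin property. Then $\mathcal{A}\rtimes_\alpha G$ is just-infinite.
   Context: A C*-algebra is just-infinite if it is infinite-dimensional and every quotient by a nonzero closed two-sided ideal is finite-dimensional. An action $\alpha$ of a finite group $G$ on a C*-algebra $\mathcal{A}$ has the Rokhlin property if for every $\varepsilon>0$ and finite $\mathcal{F}\subseteq\mathcal{A}$ there are mutually orthogonal positive contractions $(r_g)_{g\in G}\subseteq\mathcal{A}$ with (1) $\|\alpha_g(r_h)-r_{gh}\|<\varepsilon$ for all $g,h\in G$; (2) $\|r_ga-ar_g\|<\varepsilon$ for all $a\in\mathcal{F}$, $g\in G$; (3) $\|(\sum_{g\in G}r_g)a-a\|<\varepsilon$ for all $a\in\mathcal{F}$. *)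

(* Defs.v *)
From Stdlib Require Import Reals List.
Open Scope R_scope.

Record Cplx := mkC { Cre : R; Cim : R }.
Definition C1 : Cplx := mkC 1 0.
Definition Cneg1 : Cplx := mkC (-1) 0.
Definition Cadd (a b : Cplx) : Cplx := mkC (Cre a + Cre b) (Cim a + Cim b).
Definition Cmul (a b : Cplx) : Cplx :=
  mkC (Cre a * Cre b - Cim a * Cim b) (Cre a * Cim b + Cim a * Cre b).
Definition Cconj (a : Cplx) : Cplx := mkC (Cre a) (- Cim a).
Definition Cabs (a : Cplx) : R := sqrt (Cre a ^ 2 + Cim a ^ 2).

Record CStarAlgebra := {
  cs_car :> Type;
  cs_zero : cs_car;
  cs_add : cs_car -> cs_car -> cs_car;
  cs_opp : cs_car -> cs_car;
  cs_mul : cs_car -> cs_car -> cs_car;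
  cs_scal : Cplx -> cs_car -> cs_car;
  cs_star : cs_car -> cs_car;
  cs_norm : cs_car -> R;
  cs_addA : forall x y z, cs_add x (cs_add y z) = cs_add (cs_add x y) z;
  cs_addC : forall x y, cs_add x y = cs_add y x;
  cs_add0 : forall x, cs_add x cs_zero = x;
  cs_addN : forall x, cs_add x (cs_opp x) = cs_zero;
  cs_scal1 : forall x, cs_scal C1 x = x;
  cs_scalA : forall a b x, cs_scal a (cs_scal b x) = cs_scal (Cmul a b) x;
  cs_scalDr : forall a x y, cs_scal a (cs_add x y) = cs_add (cs_scal a x) (cs_scal a y);
  cs_scalDl : forall a b x, cs_scal (Cadd a b) x = cs_add (cs_scal a x) (cs_scal b x);
  cs_mulA : forall x y z, cs_mul x (cs_mul y z) = cs_mul (cs_mul x y) z;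
  cs_mulDl : forall x y z, cs_mul (cs_add x y) z = cs_add (cs_mul x z) (cs_mul y z);
  cs_mulDr : forall x y z, cs_mul x (cs_add y z) = cs_add (cs_mul x y) (cs_mul x z);
  cs_scal_mull : forall a x y, cs_scal a (cs_mul x y) = cs_mul (cs_scal a x) y;
  cs_scal_mulr : forall a x y, cs_scal a (cs_mul x y) = cs_mul x (cs_scal a y);
  cs_starK : forall x, cs_star (cs_star x) = x;
  cs_starD : forall x y, cs_star (cs_add x y) = cs_add (cs_star x) (cs_star y);
  cs_starZ : forall a x, cs_star (cs_scal a x) = cs_scal (Cconj a) (cs_star x);
  cs_starM : forall x y, cs_star (cs_mul x y) = cs_mul (cs_star y) (cs_star x);
  cs_norm_eq0 : forall x, cs_norm x = 0 -> x = cs_zero;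
  cs_norm_triangle : forall x y, cs_norm (cs_add x y) <= cs_norm x + cs_norm y;
  cs_normZ : forall a x, cs_norm (cs_scal a x) = Cabs a * cs_norm x;
  cs_normM : forall x y, cs_norm (cs_mul x y) <= cs_norm x * cs_norm y;
  cs_Cstar : forall x, cs_norm (cs_mul (cs_star x) x) = cs_norm x * cs_norm x;
  cs_complete : forall s : nat -> cs_car,
    (forall eps, 0 < eps -> exists N, forall n m, (N <= n)%nat -> (N <= m)%nat ->
        cs_norm (cs_add (s n) (cs_opp (s m))) < eps) ->
    exists l, forall eps, 0 < eps -> exists N, forall n, (N <= n)%nat ->
        cs_norm (cs_add (s n) (cs_opp l)) < eps
}.

Arguments cs_zero {c}.
Arguments cs_add {c}.
Arguments cs_opp {c}.
Arguments cs_mul {c}.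
Arguments cs_scal {c}.
Arguments cs_star {c}.
Arguments cs_norm {c}.

Definition norm_conv (A : CStarAlgebra) (s : nat -> A) (l : A) : Prop :=
  forall eps, 0 < eps -> exists N, forall n, (N <= n)%nat ->
    cs_norm (cs_add (s n) (cs_opp l)) < eps.

Record FinGroup := {
  fg_car :> Type;
  fg_mul : fg_car -> fg_car -> fg_car;
  fg_one : fg_car;
  fg_inv : fg_car -> fg_car;
  fg_enum : list fg_car;
  fg_enum_nodup : NoDup fg_enum;
  fg_enum_all : forall g, In g fg_enum;
  fg_mulA : forall x y z, fg_mul x (fg_mul y z) = fg_mul (fg_mul x y) z;
  fg_mul1 : forall x, fg_mul fg_one x = x;
  fg_mulV : forall x, fg_mul (fg_inv x) x = fg_one
}.
Arguments fg_mul {f}.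
Arguments fg_one {f}.
Arguments fg_inv {f}.

Definition gsum {G : FinGroup} {A : CStarAlgebra} (f : G -> A) : A :=
  fold_right (fun g acc => cs_add (f g) acc) cs_zero (fg_enum G).

Definition is_star_automorphism (A : CStarAlgebra) (phi : A -> A) : Prop :=
  (forall x y, phi (cs_add x y) = cs_add (phi x) (phi y)) /\
  (forall a x, phi (cs_scal a x) = cs_scal a (phi x)) /\
  (forall x y, phi (cs_mul x y) = cs_mul (phi x) (phi y)) /\
  (forall x, phi (cs_star x) = cs_star (phi x)) /\
  (exists psi : A -> A, (forall x, psi (phi x) = x) /\ (forall x, phi (psi x) = x)).

Definition is_action (G : FinGroup) (A : CStarAlgebra) (alpha : G -> A -> A) : Prop :=
  (forall g, is_star_automorphism A (alpha g)) /\
  (forall x, alpha fg_one x = x) /\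
  (forall g h x, alpha (fg_mul g h) x = alpha g (alpha h x)).

Definition positive_contraction (A : CStarAlgebra) (r : A) : Prop :=
  (exists y : A, r = cs_mul (cs_star y) y) /\ cs_norm r <= 1.

Definition rokhlin_property (G : FinGroup) (A : CStarAlgebra) (alpha : G -> A -> A) : Prop :=
  forall eps, 0 < eps -> forall F : list A,
    exists r : G -> A,
      (forall g, positive_contraction A (r g)) /\
      (forall g h, g <> h -> cs_mul (r g) (r h) = cs_zero) /\
      (forall g h, cs_norm (cs_add (alpha g (r h)) (cs_opp (r (fg_mul g h)))) < eps) /\
      (forall a g, In a F ->
         cs_norm (cs_add (cs_mul (r g) a) (cs_opp (cs_mul a (r g)))) < eps) /\
      (forall a, In a F -> cs_norm (cs_add (cs_mul (gsum r) a) (cs_opp a)) < eps).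

Fixpoint lsum {T : Type} (zero : T) (add : T -> T -> T) (n : nat) (f : nat -> T) : T :=
  match n with
  | O => zero
  | S k => add (lsum zero add k f) (f k)
  end.

Definition just_infinite {T : Type} (zero : T) (add : T -> T -> T)
  (mul : T -> T -> T) (scal : Cplx -> T -> T)
  (conv : (nat -> T) -> T -> Prop) : Prop :=
  let sub x y := add x (scal Cneg1 y) in
  let comb n (c : nat -> Cplx) (v : nat -> T) := lsum zero add n (fun i => scal (c i) (v i)) in
  (~ exists (n : nat) (v : nat -> T), forall x, exists c, x = comb n c v) /\
  (forall I : T -> Prop,
     I zero ->
     (forall x y, I x -> I y -> I (add x y)) ->
     (forall a x, I x -> I (scal a x)) ->
     (forall a x, I x -> I (mul a x) /\ I (mul x a)) ->
     (forall s l, (forall k, I (s k)) -> conv s l -> I l) ->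
     (exists x, I x /\ x <> zero) ->
     exists (n : nat) (v : nat -> T), forall x, exists c, I (sub x (comb n c v))).

Definition cstar_just_infinite (A : CStarAlgebra) : Prop :=
  just_infinite (@cs_zero A) cs_add cs_mul cs_scal (norm_conv A).

(** * The crossed product A ⋊_alpha G for a finite group G.
    Elements are functions G -> A (f = sum_g f(g) u_g); twisted convolution
    product; topology given by the C*-norm, i.e. the operator norm of the
    (left) regular representation on the Hilbert A-module l^2(G, A),
    (pi(f) xi)(g) = sum_k alpha_{g^-1}(f k) xi(k^-1 g). *)
Section CrossedProduct.
Variables (G : FinGroup) (A : CStarAlgebra) (alpha : G -> A -> A).

Definition cp_zero : G -> A := fun _ => cs_zero.
Definition cp_add (f h : G -> A) : G -> A := fun g => cs_add (f g) (h g).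
Definition cp_scal (c : Cplx) (f : G -> A) : G -> A := fun g => cs_scal c (f g).
Definition cp_mul (f h : G -> A) : G -> A :=
  fun g => gsum (fun k => cs_mul (f k) (alpha k (h (fg_mul (fg_inv k) g)))).
Definition cp_star (f : G -> A) : G -> A :=
  fun g => alpha g (cs_star (f (fg_inv g))).

Definition l2_inner (xi eta : G -> A) : A :=
  gsum (fun g => cs_mul (cs_star (xi g)) (eta g)).
Definition regrep (f : G -> A) (xi : G -> A) : G -> A :=
  fun g => gsum (fun k => cs_mul (alpha (fg_inv g) (f k)) (xi (fg_mul (fg_inv k) g))).

(* Convergence for the crossed-product C*-norm:
   ||f||^2 = sup { ||<pi(f) xi, pi(f) xi>|| : ||<xi, xi>|| <= 1 }. *)
Definition cp_conv (s : nat -> G -> A) (l : G -> A) : Prop :=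
  forall eps, 0 < eps -> exists N, forall n, (N <= n)%nat ->
    forall xi : G -> A, cs_norm (l2_inner xi xi) <= 1 ->
      let d := cp_add (s n) (cp_scal Cneg1 l) in
      cs_norm (l2_inner (regrep d xi) (regrep d xi)) <= eps.

Definition crossed_product_just_infinite : Prop :=
  just_infinite cp_zero cp_add cp_mul cp_scal cp_conv.
End CrossedProduct.

(* Main.v *)
(** For [f] in a closed ideal [I] and a Rokhlin tower [r], the element
    [Σ_g r_g f r_(h^-1 g)] of [I] is close to [f(h) u_h], so [I] contains every [f(h) u_h] and
    hence every [f(h) f(h)^*]. Thus [J = {a | a u_1 ∈ I}] is a nonzero closed ideal of [A], and
    [A = J + span(v_i)] for finitely many [v_i]. As [Σ_g r_g] is an approximate unit,
    [a u_g ∈ I] for [a ∈ J], and [I + span(v_i u_g)] is the whole crossed product.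

    Identifying convergence in the crossed product with coefficientwise convergence rests on
    two facts of C*-algebra theory, the monotonicity of the norm on positive elements and the
    contractivity of *-homomorphisms. They are derived without spectra: [T >= 0] is read as
    [‖t - T‖ <= t] for some [t], which is visibly additive, and square roots are iterated. *)
Require Import Defs.
From Stdlib Require Import Reals List Lra Lia Classical ClassicalDescription
  ClassicalEpsilon FunctionalExtensionality.

Declare Scope cstar_scope.
Delimit Scope cstar_scope with cs.
Notation "x ⊕ y" := (cs_add x y) (at level 50, left associativity) : cstar_scope.
Notation "⊖ x" := (cs_opp x) (at level 35, right associativity) : cstar_scope.
Notation "x ⊖ y" := (cs_add x (cs_opp y)) (at level 50, left associativity) : cstar_scope.
Notation "x ⊙ y" := (cs_mul x y) (at level 40, left associativity) : cstar_scope.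
Notation "x ^*" := (cs_star x) (at level 1, format "x ^*") : cstar_scope.
Notation "‖ x ‖" := (cs_norm x) (at level 20, x at level 99, format "‖ x ‖") : cstar_scope.
(** Real scalars are kept apart from complex ones so that the coefficients of a linear identity live
    in [R], where [field] and [lra] apply. *)
Definition rs {A : CStarAlgebra} (t : R) (x : A) : A := cs_scal (mkC t 0) x.
Notation "t • x" := (rs t x) (at level 39, right associativity) : cstar_scope.
Open Scope R_scope.
Open Scope cstar_scope.

(** * Linear arithmetic in a C*-algebra *)

Section RealScalars.
Context {A : CStarAlgebra}.
Implicit Types x y z : A.

Lemma rs_rs s t x : s • t • x = (s * t) • x.
Proof. unfold rs. rewrite cs_scalA. f_equal. unfold Cmul; simpl; f_equal; ring. Qed.

Lemma rs_add t x y : t • (x ⊕ y) = t • x ⊕ t • y.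
Proof. apply cs_scalDr. Qed.

Lemma rs_plus s t x : (s + t) • x = s • x ⊕ t • x.
Proof.
  unfold rs. rewrite <- cs_scalDl. f_equal. unfold Cadd; simpl; f_equal; ring.
Qed.

Lemma rs_1 x : 1 • x = x.
Proof. apply cs_scal1. Qed.

Lemma add0l x : cs_zero ⊕ x = x.
Proof. rewrite cs_addC. apply cs_add0. Qed.

Lemma add_cancel x y z : x ⊕ z = y ⊕ z -> x = y.
Proof.
  intros E. rewrite <- (cs_add0 _ x), <- (cs_add0 _ y), <- (cs_addN _ z), !cs_addA, E.
  reflexivity.
Qed.

Lemma scal_C0 x : cs_scal (mkC 0 0) x = cs_zero.
Proof.
  apply add_cancel with (z := cs_scal (mkC 0 0) x).
  rewrite <- cs_scalDl, add0l. f_equal. unfold Cadd; simpl; f_equal; ring.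
Qed.

Lemma rs_0 x : 0 • x = cs_zero.
Proof. apply scal_C0. Qed.

Lemma opp_rs x : ⊖ x = (-1) • x.
Proof.
  apply add_cancel with (z := x). rewrite (cs_addC _ (⊖ x)), cs_addN.
  rewrite <- (rs_1 x) at 2. rewrite <- rs_plus.
  replace (-1 + 1) with 0 by ring. now rewrite rs_0.
Qed.

Lemma rs_zero t : t • (cs_zero : A) = cs_zero.
Proof. rewrite <- (rs_0 cs_zero) at 1. rewrite rs_rs, Rmult_0_r. apply rs_0. Qed.

(* Reflexive decision of linear identities with coefficients in R. *)
Inductive vexp :=
| VAtom (n : nat) | VZero | VAdd (e f : vexp) | VOpp (e : vexp) | VScal (t : R) (e : vexp).

Fixpoint veval (l : list A) (e : vexp) : A :=
  match e with
  | VAtom n => nth n l cs_zero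
  | VZero => cs_zero
  | VAdd e f => veval l e ⊕ veval l f
  | VOpp e => ⊖ veval l e
  | VScal t e => t • veval l e
  end.

Fixpoint vcoef (e : vexp) (n : nat) : R :=
  match e with
  | VAtom m => if Nat.eqb m n then 1 else 0
  | VZero => 0
  | VAdd e f => vcoef e n + vcoef f n
  | VOpp e => - vcoef e n
  | VScal t e => t * vcoef e n
  end.

Fixpoint vlin (l : list A) (c : nat -> R) : A :=
  match l with
  | nil => cs_zero
  | x :: l => c O • x ⊕ vlin l (fun n => c (S n))
  end.

Lemma vlin_zero l : vlin l (fun _ => 0) = cs_zero.
Proof. induction l as [|x l IH]; simpl; [reflexivity|]. now rewrite IH, rs_0, cs_add0. Qed.

Lemma vlin_add l c d : vlin l (fun n => c n + d n) = vlin l c ⊕ vlin l d.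
Proof.
  revert c d; induction l as [|x l IH]; intros c d; simpl; [now rewrite cs_add0|].
  rewrite (IH (fun n => c (S n)) (fun n => d (S n))), rs_plus, !cs_addA. f_equal.
  rewrite <- !cs_addA. f_equal. apply cs_addC.
Qed.

Lemma vlin_scal l t c : vlin l (fun n => t * c n) = t • vlin l c.
Proof.
  revert c; induction l as [|x l IH]; intros c; simpl; [now rewrite rs_zero|].
  now rewrite (IH (fun n => c (S n))), rs_add, rs_rs.
Qed.

Lemma vlin_ext l c d : (forall n, (n < length l)%nat -> c n = d n) -> vlin l c = vlin l d.
Proof.
  revert c d; induction l as [|x l IH]; intros c d E; simpl; [reflexivity|].
  rewrite (E O) by (simpl; lia). f_equal. apply IH. intros n Hn. apply E. simpl; lia.
Qed.

Lemma vlin_atom l m : vlin l (fun n => if Nat.eqb m n then 1 else 0) = nth m l cs_zero.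
Proof.
  revert m; induction l as [|x l IH]; intros [|m]; simpl; try reflexivity.
  - rewrite vlin_zero, rs_1. apply cs_add0.
  - rewrite rs_0, add0l. apply IH.
Qed.

Lemma veval_vlin l e : veval l e = vlin l (vcoef e).
Proof.
  induction e as [n| |e IHe f IHf|e IHe|t e IHe]; simpl.
  - symmetry; apply vlin_atom.
  - symmetry; apply vlin_zero.
  - now rewrite IHe, IHf, <- vlin_add.
  - rewrite opp_rs, IHe, <- vlin_scal. apply vlin_ext. intros; ring.
  - now rewrite IHe, <- vlin_scal.
Qed.

(** A finite conjunction rather than a bounded quantifier, so that [cbn] leaves one real equation
    per atom. *)
Fixpoint vagree (n : nat) (e f : vexp) : Prop :=
  match n with
  | O => True
  | S k => vcoef e k = vcoef f k /\ vagree k e f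
  end.

Lemma veval_eq l e f : vagree (length l) e f -> veval l e = veval l f.
Proof.
  intros E. rewrite !veval_vlin. apply vlin_ext.
  revert E. generalize (length l) as n. induction n as [|n IH]; intros E k Hk; [lia|].
  destruct E as [E1 E2]. destruct (Nat.eq_dec k n) as [->|Hn]; [exact E1|].
  apply IH; [exact E2|lia].
Qed.

End RealScalars.

(** * Tactic for linear identities *)

Ltac vinsert x l :=
  lazymatch l with
  | nil => constr:(x :: nil)
  | x :: _ => l
  | ?y :: ?m => let m' := vinsert x m in constr:(y :: m')
  end.
Ltac vlookup x l :=
  lazymatch l with
  | x :: _ => constr:(O)
  | _ :: ?m => let n := vlookup x m in constr:(S n)
  end.
Ltac vatoms e l :=
  lazymatch e with
  | cs_zero => l
  | cs_add ?x ?y => let l := vatoms x l in vatoms y l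
  | cs_opp ?x => vatoms x l
  | rs _ ?x => vatoms x l
  | cs_scal Cneg1 ?x => vatoms x l
  | _ => vinsert e l
  end.
Ltac vreify e l :=
  lazymatch e with
  | cs_zero => constr:(VZero)
  | cs_add ?x ?y => let a := vreify x l in let b := vreify y l in constr:(VAdd a b)
  | cs_opp ?x => let a := vreify x l in constr:(VOpp a)
  | rs ?t ?x => let a := vreify x l in constr:(VScal t a)
  | cs_scal Cneg1 ?x => let a := vreify x l in constr:(VScal (-1) a)
  | _ => let n := vlookup e l in constr:(VAtom n)
  end.
Ltac vec :=
  lazymatch goal with
  | |- @eq ?T ?x ?y =>
      lazymatch T with cs_car ?A =>
      let l := vatoms x (@nil (cs_car A)) in
      let l := vatoms y l in
      let a := vreify x l in
      let b := vreify y l in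
      change (veval l a = veval l b);
      apply veval_eq; cbn [length vagree vcoef Nat.eqb];
      repeat split; try field; try assumption; try lra
      end
  end.

(** * Norm, involution and cancellation *)

Section Basics.
Context {A : CStarAlgebra}.
Implicit Types x y z : A.

Lemma rs_mull t x y : (t • x) ⊙ y = t • (x ⊙ y).
Proof. unfold rs. now rewrite cs_scal_mull. Qed.

Lemma rs_mulr t x y : x ⊙ (t • y) = t • (x ⊙ y).
Proof. unfold rs. now rewrite cs_scal_mulr. Qed.

Lemma mul0l x : cs_zero ⊙ x = cs_zero.
Proof. rewrite <- (rs_0 cs_zero), rs_mull, rs_0. now rewrite rs_0. Qed.

Lemma mul0r x : x ⊙ cs_zero = cs_zero.
Proof. rewrite <- (rs_0 cs_zero), rs_mulr, rs_0. now rewrite rs_0. Qed.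

Lemma mulNl x y : (⊖ x) ⊙ y = ⊖ (x ⊙ y).
Proof. now rewrite !opp_rs, rs_mull. Qed.

Lemma mulNr x y : x ⊙ (⊖ y) = ⊖ (x ⊙ y).
Proof. now rewrite !opp_rs, rs_mulr. Qed.

Lemma star_rs t x : (t • x)^* = t • x^*.
Proof. unfold rs. rewrite cs_starZ. unfold Cconj; simpl. now rewrite Ropp_0. Qed.

Lemma star0 : (cs_zero : A)^* = cs_zero.
Proof. now rewrite <- (rs_0 cs_zero), star_rs, !rs_0. Qed.

Lemma starN x : (⊖ x)^* = ⊖ x^*.
Proof. now rewrite !opp_rs, star_rs. Qed.

Definition ci x : A := cs_scal (mkC 0 1) x.

Lemma ci_ci x : ci (ci x) = ⊖ x.
Proof.
  rewrite opp_rs. unfold ci, rs. rewrite cs_scalA. f_equal.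
  unfold Cmul; simpl; f_equal; ring.
Qed.

Lemma ci_add x y : ci (x ⊕ y) = ci x ⊕ ci y.
Proof. apply cs_scalDr. Qed.

Lemma ci_opp x : ci (⊖ x) = ⊖ ci x.
Proof.
  rewrite !opp_rs. unfold ci, rs. rewrite !cs_scalA. f_equal.
  unfold Cmul; simpl; f_equal; ring.
Qed.

Lemma star_ci x : (ci x)^* = ⊖ ci x^*.
Proof.
  rewrite opp_rs. unfold ci, rs. rewrite cs_starZ, cs_scalA. f_equal.
  unfold Cmul, Cconj; simpl; f_equal; ring.
Qed.

Lemma ci_mull x y : ci x ⊙ y = ci (x ⊙ y).
Proof. unfold ci. now rewrite cs_scal_mull. Qed.

Lemma ci_mulr x y : x ⊙ ci y = ci (x ⊙ y).
Proof. unfold ci. now rewrite cs_scal_mulr. Qed.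

Lemma norm_rs t x : ‖t • x‖ = Rabs t * ‖x‖.
Proof.
  unfold rs. rewrite cs_normZ. f_equal. unfold Cabs; simpl.
  replace (t * (t * 1) + 0 * (0 * 1)) with (Rsqr t) by (unfold Rsqr; ring).
  apply sqrt_Rsqr_abs.
Qed.

Lemma norm_rs_pos t x : 0 <= t -> ‖t • x‖ = t * ‖x‖.
Proof. intros Ht. now rewrite norm_rs, Rabs_right by lra. Qed.

Lemma norm0 : ‖(cs_zero : A)‖ = 0.
Proof. rewrite <- (rs_0 cs_zero), norm_rs_pos by lra. ring. Qed.

Lemma normN x : ‖⊖ x‖ = ‖x‖.
Proof. rewrite opp_rs, norm_rs, Rabs_left by lra. ring. Qed.

Lemma norm_ge0 x : 0 <= ‖x‖.
Proof.
  pose proof (cs_norm_triangle _ x (⊖ x)) as T. rewrite cs_addN, norm0, normN in T. lra.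
Qed.

Lemma normB x y : ‖x ⊖ y‖ <= ‖x‖ + ‖y‖.
Proof. rewrite <- (normN y). apply cs_norm_triangle. Qed.

Lemma norm_subC x y : ‖x ⊖ y‖ = ‖y ⊖ x‖.
Proof. rewrite <- normN. f_equal. vec. Qed.

Lemma norm_le_add x y : ‖x‖ <= ‖x ⊖ y‖ + ‖y‖.
Proof. replace x with ((x ⊖ y) ⊕ y) at 1 by vec. apply cs_norm_triangle. Qed.

Lemma norm_dist x y z : ‖x ⊖ z‖ <= ‖x ⊖ y‖ + ‖y ⊖ z‖.
Proof. replace (x ⊖ z) with ((x ⊖ y) ⊕ (y ⊖ z)) by vec. apply cs_norm_triangle. Qed.

(** From [‖y‖^2 = ‖y^* y‖ <= ‖y^*‖ ‖y‖] one gets [‖y‖ <= ‖y^*‖], which is used for [x] and for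
    [x^*]. *)
Lemma norm_star x : ‖x^*‖ = ‖x‖.
Proof.
  assert (H : forall y, ‖y‖ <= ‖y^*‖).
  { intros y. pose proof (cs_Cstar _ y) as E. pose proof (cs_normM _ (y^*) y) as L.
    pose proof (norm_ge0 y). pose proof (norm_ge0 (y^*)).
    destruct (Req_dec (‖y‖) 0); [lra|].
    apply Rmult_le_reg_r with (‖y‖); lra. }
  apply Rle_antisym; [|apply H]. rewrite <- (cs_starK _ x) at 2. apply H.
Qed.

Lemma norm_mul_le x y a b : ‖x‖ <= a -> ‖y‖ <= b -> ‖x ⊙ y‖ <= a * b.
Proof.
  intros Hx Hy. eapply Rle_trans; [apply cs_normM|].
  apply Rmult_le_compat; auto using norm_ge0.
Qed.

Lemma Cstar_eq0 x : x^* ⊙ x = cs_zero -> x = cs_zero.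
Proof.
  intros E. apply cs_norm_eq0. pose proof (cs_Cstar _ x) as C. rewrite E, norm0 in C.
  symmetry in C. apply Rmult_integral in C. tauto.
Qed.

Lemma sub_eq0 x y : x ⊖ y = cs_zero -> x = y.
Proof. intros E. replace x with ((x ⊖ y) ⊕ y) by vec. rewrite E. apply add0l. Qed.

(** With [d = x ⊖ y] the hypothesis makes [d^* d] vanish. As [A] may lack a unit, equalities are
    tested against all elements. *)
Lemma mul_cancell x y : (forall d, d^* ⊙ x = d^* ⊙ y) -> x = y.
Proof.
  intros H. apply sub_eq0, Cstar_eq0. rewrite cs_mulDr, mulNr, H. apply cs_addN.
Qed.

Lemma mul_cancelr x y : (forall d, x ⊙ d = y ⊙ d) -> x = y.
Proof.
  intros H. rewrite <- (cs_starK _ x), <- (cs_starK _ y). f_equal.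
  apply mul_cancell. intros d. now rewrite <- !cs_starM, H.
Qed.

Lemma norm_eps0 x : (forall eps, 0 < eps -> ‖x‖ <= eps) -> x = cs_zero.
Proof.
  intros H. apply cs_norm_eq0, Rle_antisym; [|apply norm_ge0].
  apply le_epsilon. intros eps He. rewrite Rplus_0_l. now apply H.
Qed.

(** * Limits *)

Lemma conv_unique s x y : norm_conv A s x -> norm_conv A s y -> x = y.
Proof.
  intros Hx Hy. apply sub_eq0, norm_eps0. intros eps He.
  destruct (Hx (eps / 2)) as [N HN]; [lra|]. destruct (Hy (eps / 2)) as [M HM]; [lra|].
  specialize (HN (N + M)%nat ltac:(lia)). specialize (HM (N + M)%nat ltac:(lia)).
  pose proof (norm_dist x (s (N + M)%nat) y) as T. 
  rewrite (norm_subC x (s _)) in T. lra.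
Qed.

Lemma conv_bound s x M : (forall n, ‖s n‖ <= M) -> norm_conv A s x -> ‖x‖ <= M.
Proof.
  intros Hs Hx. apply le_epsilon. intros eps He. destruct (Hx eps He) as [N HN].
  specialize (HN N (le_n N)). pose proof (norm_le_add x (s N)) as T.
  rewrite norm_subC in T. specialize (Hs N). lra.
Qed.

Lemma conv_shift s x : norm_conv A s x -> norm_conv A (fun n => s (S n)) x.
Proof. intros H eps He. destruct (H eps He) as [N HN]. exists N. intros; apply HN; lia. Qed.

Lemma conv_const x : norm_conv A (fun _ => x) x.
Proof. intros eps He. exists O. intros. now rewrite cs_addN, norm0. Qed.

Lemma conv_dom s x s' x' M : norm_conv A s x ->
  (forall n, ‖s' n ⊖ x'‖ <= M * ‖s n ⊖ x‖) -> norm_conv A s' x'.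
Proof.
  intros H D eps He. pose proof (Rabs_pos M). pose proof (Rle_abs M).
  destruct (H (eps / (Rabs M + 1))) as [N HN]; [apply Rdiv_lt_0_compat; lra|].
  exists N. intros n Hn. specialize (HN n Hn). specialize (D n).
  pose proof (norm_ge0 (s n ⊖ x)).
  apply (Rmult_lt_compat_l (Rabs M + 1)) in HN; [|lra].
  replace ((Rabs M + 1) * (eps / (Rabs M + 1))) with eps in HN by (field; lra).
  nra.
Qed.

Lemma conv_add s x s' x' : norm_conv A s x -> norm_conv A s' x' ->
  norm_conv A (fun n => s n ⊕ s' n) (x ⊕ x').
Proof.
  intros H H' eps He. destruct (H (eps / 2)) as [N HN]; [lra|].
  destruct (H' (eps / 2)) as [N' HN']; [lra|]. exists (N + N')%nat. intros n Hn.
  specialize (HN n ltac:(lia)). specialize (HN' n ltac:(lia)).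
  replace (s n ⊕ s' n ⊖ (x ⊕ x')) with ((s n ⊖ x) ⊕ (s' n ⊖ x')) by vec.
  pose proof (cs_norm_triangle _ (s n ⊖ x) (s' n ⊖ x')). lra.
Qed.

Lemma conv_rs t s x : norm_conv A s x -> norm_conv A (fun n => t • s n) (t • x).
Proof.
  intros H. apply (conv_dom _ _ _ _ (Rabs t) H). intros n.
  replace (t • s n ⊖ t • x) with (t • (s n ⊖ x)) by vec. rewrite norm_rs. apply Rle_refl.
Qed.

Lemma conv_mull c s x : norm_conv A s x -> norm_conv A (fun n => c ⊙ s n) (c ⊙ x).
Proof.
  intros H. apply (conv_dom _ _ _ _ (‖c‖) H). intros n.
  rewrite <- mulNr, <- cs_mulDr. apply cs_normM.
Qed.

Lemma conv_mulr c s x : norm_conv A s x -> norm_conv A (fun n => s n ⊙ c) (x ⊙ c).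
Proof.
  intros H. apply (conv_dom _ _ _ _ (‖c‖) H). intros n.
  rewrite <- mulNl, <- cs_mulDl, Rmult_comm. apply cs_normM.
Qed.

Lemma conv_star s x : norm_conv A s x -> norm_conv A (fun n => (s n)^*) (x^*).
Proof.
  intros H. apply (conv_dom _ _ _ _ 1 H). intros n.
  rewrite <- starN, <- cs_starD, norm_star. lra.
Qed.

End Basics.

(* Expands products and stars into sums of monomials, which [vec] then treats as atoms. *)
#[export] Hint Rewrite @cs_mulDl @cs_mulDr @cs_mulA @cs_starK @cs_starD @cs_starM
  @rs_mull @rs_mulr @mul0l @mul0r @mulNl @mulNr @star_rs @star0 @starN
  @ci_ci @ci_add @ci_opp @star_ci @ci_mull @ci_mulr : cstar.

(** * Positive operators on a C*-algebra *)

Section Operators.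
Context {A : CStarAlgebra}.
Implicit Types (x y z a b c : A) (S T K : A -> A).

(** Self-adjointness for the [A]-valued inner product [b^* c]: these operators are self-adjoint
    multipliers of [A]. The identity operator supplies the unit that [A] may lack. *)
Definition sym T : Prop := forall b c, (T b)^* ⊙ c = b^* ⊙ T c.
Definition bd T (M : R) : Prop := forall b, ‖T b‖ <= M * ‖b‖.
Definition comm S T : Prop := forall b, S (T b) = T (S b).
Definition blin T : Prop :=
  (forall x y, T (x ⊕ y) = T x ⊕ T y) /\ (forall t x, T (t • x) = t • T x) /\
  exists M, bd T M.

(* For [t >= ‖T‖] this norm condition characterizes positivity without spectra. *)
Definition psd T : Prop :=
  sym T /\ exists t, 0 < t /\ bd (fun b => t • b ⊖ T b) t.

(** Linearity is automatic: [T] is moved to the other side of the inner product, the sum is split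
    there, and [T] is moved back. *)
Lemma sym_add T x y : sym T -> T (x ⊕ y) = T x ⊕ T y.
Proof.
  intros H. apply mul_cancell. intros d.
  now rewrite <- H, !cs_mulDr, <- !H.
Qed.

Lemma sym_rs T t x : sym T -> T (t • x) = t • T x.
Proof.
  intros H. apply mul_cancell. intros d. now rewrite <- H, !rs_mulr, <- H.
Qed.

Lemma sym_opp T x : sym T -> T (⊖ x) = ⊖ T x.
Proof. intros H. now rewrite !opp_rs, sym_rs. Qed.

Lemma sym_mul T x y : sym T -> T (x ⊙ y) = T x ⊙ y.
Proof.
  intros H. apply mul_cancell. intros d.
  now rewrite <- H, !cs_mulA, <- H.
Qed.

Lemma sym_comp S T : sym S -> sym T -> comm S T -> sym (fun b => S (T b)).
Proof. intros HS HT C b c. now rewrite HS, HT, C. Qed.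

Lemma sym_sum S T : sym S -> sym T -> sym (fun b => S b ⊕ T b).
Proof. intros HS HT b c. now rewrite cs_starD, cs_mulDl, cs_mulDr, HS, HT. Qed.

Lemma sym_scal t T : sym T -> sym (fun b => t • T b).
Proof. intros HT b c. now rewrite star_rs, rs_mull, rs_mulr, HT. Qed.

Lemma sym_neg T : sym T -> sym (fun b => ⊖ T b).
Proof. intros HT b c. now rewrite starN, mulNl, mulNr, HT. Qed.

Lemma sym_id : sym (fun b => b).
Proof. now intros b c. Qed.

Lemma sym_blin T M : sym T -> bd T M -> blin T.
Proof.
  intros HS HB. split; [intros; now apply sym_add|].
  split; [intros; now apply sym_rs|]. now exists M.
Qed.

Lemma blin_opp T x : blin T -> T (⊖ x) = ⊖ T x.
Proof. intros [_ [H _]]. now rewrite !opp_rs, H. Qed.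

Lemma conv_blin T s x : blin T -> norm_conv A s x -> norm_conv A (fun n => T (s n)) (T x).
Proof.
  intros HT H. pose proof (fun x => blin_opp T x HT) as HO.
  destruct HT as [HA [_ [M HM]]]. apply (conv_dom _ _ _ _ M H). intros n.
  rewrite <- HO, <- HA. apply HM.
Qed.

Lemma bd_weaken T M M' : M <= M' -> bd T M -> bd T M'.
Proof.
  intros L H b. eapply Rle_trans; [apply H|].
  apply Rmult_le_compat_r; [apply norm_ge0|exact L].
Qed.

Lemma bd_comp S T M M' : 0 <= M -> bd S M -> bd T M' -> bd (fun b => S (T b)) (M * M').
Proof.
  intros HM HS HT b. eapply Rle_trans; [apply HS|].
  rewrite Rmult_assoc. apply Rmult_le_compat_l; [exact HM|apply HT].
Qed.

Lemma psd_sym T : psd T -> sym T.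
Proof. now intros []. Qed.

Lemma psd_bd T : psd T -> exists M, 0 <= M /\ bd T M.
Proof.
  intros [HS [t [Ht H]]]. exists (t + t). split; [lra|]. intros b.
  replace (T b) with (t • b ⊖ (t • b ⊖ T b)) by vec.
  eapply Rle_trans; [apply normB|]. rewrite norm_rs_pos by lra. specialize (H b); simpl in H. lra.
Qed.

Lemma psd_blin T : psd T -> blin T.
Proof.
  intros H. destruct (psd_bd T H) as [M [_ HM]]. apply sym_blin with M; [apply H|exact HM].
Qed.

Lemma psd_ext S T : (forall b, S b = T b) -> psd S -> psd T.
Proof. intros E. replace T with S; [auto|]. now apply functional_extensionality. Qed.

Lemma psd_add S T : psd S -> psd T -> psd (fun b => S b ⊕ T b).
Proof.
  intros [SS [s [Hs BS]]] [ST [t [Ht BT]]]. split; [now apply sym_sum|].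
  exists (s + t). split; [lra|]. intros b.
  replace ((s + t) • b ⊖ (S b ⊕ T b)) with ((s • b ⊖ S b) ⊕ (t • b ⊖ T b)) by vec.
  eapply Rle_trans; [apply cs_norm_triangle|]. specialize (BS b). specialize (BT b).
  simpl in BS, BT. lra.
Qed.

(* [K + iL] is a multiple of an isometry, and [2K] is its sum with [K - iL]. *)
Lemma sum_squares_bd K S m : 0 <= m -> sym K -> sym S -> comm K S ->
  (forall b, K (K b) ⊕ S (S b) = (m * m) • b) -> bd K m.
Proof.
  intros Hm SK SS C E b.
  assert (F : forall x, x^* ⊙ x = (m * m) • (b^* ⊙ b) -> ‖x‖ = m * ‖b‖).
  { intros x Hx. pose proof (cs_Cstar _ x) as Q. rewrite Hx, norm_rs_pos, cs_Cstar in Q by nra.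
    apply Rsqr_inj; [apply norm_ge0| |unfold Rsqr; lra].
    apply Rmult_le_pos; [lra|apply norm_ge0]. }
  assert (G : b^* ⊙ K (K b) ⊕ b^* ⊙ S (S b) = (m * m) • (b^* ⊙ b)).
  { now rewrite <- cs_mulDr, E, rs_mulr. }
  assert (H1 : ‖K b ⊕ ci (S b)‖ = m * ‖b‖).
  (* The cross terms of [(K b + i S b)^* (K b + i S b)] cancel because [K] and [S] commute. *)
  { apply F. rewrite <- G. autorewrite with cstar. rewrite !SK, !SS, C. vec. }
  assert (H2 : ‖K b ⊖ ci (S b)‖ = m * ‖b‖).
  { apply F. rewrite <- G. autorewrite with cstar. rewrite !SK, !SS, C. vec. }
  replace (K b) with ((1 / 2) • ((K b ⊕ ci (S b)) ⊕ (K b ⊖ ci (S b)))) by vec.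
  rewrite norm_rs_pos by lra.
  pose proof (cs_norm_triangle _ (K b ⊕ ci (S b)) (K b ⊖ ci (S b))). lra.
Qed.

End Operators.

(* The square root of [1 - X] is [1 - Z], where [Z] is the limit of [Z' = (X + Z^2) / 2];
   the scalar iteration [z' = (1 + z^2) / 2] dominates it. *)
Section SquareRoot.
Context {A : CStarAlgebra} (X : A -> A).
Hypotheses (SX : sym X) (BX : bd X 1).

Fixpoint sqrt_iter (n : nat) (b : A) : A :=
  match n with
  | O => cs_zero
  | S k => (1 / 2) • (X b ⊕ sqrt_iter k (sqrt_iter k b))
  end.

Fixpoint scalar_iter (n : nat) : R :=
  match n with
  | O => 0
  | S k => 1 / 2 * (1 + scalar_iter k * scalar_iter k)
  end.

Lemma scalar_iter_bounds n : 0 <= scalar_iter n <= 1.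
Proof. induction n; simpl; [lra|nra]. Qed.

Lemma scalar_iter_growing : Un_growing scalar_iter.
Proof. intros n; simpl. pose proof (scalar_iter_bounds n). nra. Qed.

Lemma sqrt_iter_sym n : sym (sqrt_iter n).
Proof.
  induction n as [|n IH]; simpl.
  - intros b c. now rewrite star0, mul0l, mul0r.
  - apply sym_scal, sym_sum; [exact SX|]. now apply sym_comp.
Qed.

Lemma sqrt_iter_bd n : bd (sqrt_iter n) (scalar_iter n).
Proof.
  induction n as [|n IH]; intros b; simpl; [rewrite norm0; lra|].
  rewrite norm_rs_pos by lra.
  pose proof (cs_norm_triangle _ (X b) (sqrt_iter n (sqrt_iter n b))).
  pose proof (BX b). pose proof (scalar_iter_bounds n) as Hz.
  pose proof (bd_comp _ _ _ _ (proj1 Hz) IH IH b) as L. simpl in L. lra.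
Qed.

(** The factorization [Z1^2 - Z0^2 = Z1 (Z1 - Z0) + (Z1 - Z0) Z0] has the same form for operators
    and scalars, so the bound propagates by induction. *)
Lemma sqrt_iter_step n b : ‖sqrt_iter (S n) b ⊖ sqrt_iter n b‖
  <= (scalar_iter (S n) - scalar_iter n) * ‖b‖.
Proof.
  revert b; induction n as [|n IH]; intros b.
  - simpl. replace ((1 / 2) • (X b ⊕ cs_zero) ⊖ cs_zero) with ((1 / 2) • X b) by vec.
    rewrite norm_rs_pos by lra. specialize (BX b). lra.
  - set (Z1 := sqrt_iter (S n)) in *. set (Z0 := sqrt_iter n) in *.
    set (z1 := scalar_iter (S n)) in *. set (z0 := scalar_iter n) in *.
    change (sqrt_iter (S (S n)) b) with ((1 / 2) • (X b ⊕ Z1 (Z1 b))).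
    change (scalar_iter (S (S n))) with (1 / 2 * (1 + z1 * z1)).
    replace ((1 / 2) • (X b ⊕ Z1 (Z1 b)) ⊖ Z1 b) with
      ((1 / 2) • (Z1 (Z1 b ⊖ Z0 b) ⊕ (Z1 (Z0 b) ⊖ Z0 (Z0 b)))).
    2:{ rewrite (sym_add Z1), (sym_opp Z1) by apply sqrt_iter_sym.
        replace (X b) with (2 • Z1 b ⊖ Z0 (Z0 b)).
        2:{ change (Z1 b) with ((1 / 2) • (X b ⊕ Z0 (Z0 b))). vec. }
        vec. }
    rewrite norm_rs_pos by lra.
    replace ((1 / 2 * (1 + z1 * z1) - z1) * ‖b‖)
      with (1 / 2 * (z1 * ((z1 - z0) * ‖b‖) + (z1 - z0) * (z0 * ‖b‖))).
    (* Since [z1 = (1 + z0^2) / 2], both sides are [(z1^2 - z0^2) / 2] times [‖b‖]. *)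
    2:{ unfold z1 at 5. simpl. fold z0. unfold z1; simpl; fold z0. field. }
    apply Rmult_le_compat_l; [lra|].
    eapply Rle_trans; [apply cs_norm_triangle|]. apply Rplus_le_compat.
    + eapply Rle_trans; [apply sqrt_iter_bd|].
      apply Rmult_le_compat_l; [apply scalar_iter_bounds|apply IH].
    + eapply Rle_trans; [apply IH|]. apply Rmult_le_compat_l.
      * pose proof (scalar_iter_growing n). unfold z1, z0. lra.
      * apply sqrt_iter_bd.
Qed.

Lemma sqrt_iter_dist n k b : ‖sqrt_iter (k + n) b ⊖ sqrt_iter n b‖
  <= (scalar_iter (k + n) - scalar_iter n) * ‖b‖.
Proof.
  induction k as [|k IH].
  - simpl (0 + n)%nat. rewrite cs_addN, norm0. lra.
  - eapply Rle_trans; [apply (norm_dist _ (sqrt_iter (k + n) b))|].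
    pose proof (sqrt_iter_step (k + n) b). simpl (S k + n)%nat. lra.
Qed.

(** The scalar iterates increase and stay below [1], so they are Cauchy, and they dominate the
    distances of the operator iterates. *)
Lemma sqrt_iter_cv b : exists l, norm_conv A (fun n => sqrt_iter n b) l.
Proof.
  apply cs_complete. intros eps He.
  assert (CC : Cauchy_crit scalar_iter).
  { apply CV_Cauchy, growing_cv; [apply scalar_iter_growing|].
    exists 1. intros x [n ->]. apply scalar_iter_bounds. }
  pose proof (norm_ge0 b).
  destruct (CC (eps / (‖b‖ + 1))) as [N HN]; [apply Rdiv_lt_0_compat; lra|].
  assert (Q : forall n m, (N <= n)%nat -> (n <= m)%nat ->
    ‖sqrt_iter m b ⊖ sqrt_iter n b‖ < eps).
  { intros n m Hn Hm. specialize (HN m n ltac:(lia) ltac:(lia)). unfold Rdist in HN.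
    pose proof (Rle_abs (scalar_iter m - scalar_iter n)) as P.
    pose proof (sqrt_iter_dist n (m - n) b) as D.
    replace (m - n + n)%nat with m in D by lia.
    apply (Rmult_lt_compat_l (‖b‖ + 1)) in HN; [|lra].
    replace ((‖b‖ + 1) * (eps / (‖b‖ + 1))) with eps in HN by (field; lra).
    pose proof (Rabs_pos (scalar_iter m - scalar_iter n)). nra. }
  exists N. intros n m Hn Hm. destruct (Nat.le_ge_cases n m) as [L|L].
  - rewrite norm_subC. now apply Q.
  - apply Q; lia.
Qed.

(** Expanding [Z = (X + Z^2) / 2] gives [(1 - Z)^2 = 1 - X], and [‖Z‖ <= 1] makes [1 - Z] positive
    with [t = 1]. The iterates are polynomials in [X], so commutation with [X] passes to the
    limit. *)
Lemma sqrt_one_minus : exists Y, psd Y /\ (forall b, Y (Y b) = b ⊖ X b) /\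
  (forall T, blin T -> comm T X -> comm T Y).
Proof.
  set (Z := fun b => epsilon (inhabits cs_zero) (norm_conv A (fun n => sqrt_iter n b))).
  assert (HZ : forall b, norm_conv A (fun n => sqrt_iter n b) (Z b)).
  { intros b. apply epsilon_spec, sqrt_iter_cv. }
  assert (BZ : bd Z 1).
  { intros b. apply (conv_bound (fun n => sqrt_iter n b)); [|apply HZ]. intros n.
    apply (bd_weaken _ (scalar_iter n)); [apply scalar_iter_bounds|apply sqrt_iter_bd]. }
  assert (SZ : sym Z).
  { intros b c. apply (conv_unique (fun n => (sqrt_iter n b)^* ⊙ c)).
    - apply conv_mulr, conv_star, HZ.
    - replace (fun n => (sqrt_iter n b)^* ⊙ c) with (fun n => b^* ⊙ sqrt_iter n c).
      + apply conv_mull, HZ.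
      + apply functional_extensionality. intros n. symmetry. apply sqrt_iter_sym. }
  assert (EZ : forall b, Z b = (1 / 2) • (X b ⊕ Z (Z b))).
  { intros b. apply (conv_unique (fun n => sqrt_iter (S n) b)).
    - apply (conv_shift (fun n => sqrt_iter n b)), HZ.
    - change (norm_conv A (fun n => (1 / 2) • (X b ⊕ sqrt_iter n (sqrt_iter n b)))
        ((1 / 2) • (X b ⊕ Z (Z b)))).
      apply conv_rs, conv_add; [apply conv_const|].
      (* Operator and argument both vary with [n]. Contractivity of the iterates sends the first
         term to zero; the second has the fixed argument [Z b]. *)
      replace (fun n => sqrt_iter n (sqrt_iter n b)) with
        (fun n => sqrt_iter n (sqrt_iter n b ⊖ Z b) ⊕ sqrt_iter n (Z b)).
      + rewrite <- (add0l (Z (Z b))). apply conv_add; [|apply HZ].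
        apply (conv_dom _ _ _ _ 1 (HZ b)). intros n.
        replace (sqrt_iter n (sqrt_iter n b ⊖ Z b) ⊖ cs_zero)
          with (sqrt_iter n (sqrt_iter n b ⊖ Z b)) by vec.
        apply (bd_weaken _ (scalar_iter n)); [apply scalar_iter_bounds|apply sqrt_iter_bd].
      + apply functional_extensionality. intros n.
        rewrite (sym_add (sqrt_iter n)), (sym_opp (sqrt_iter n)) by apply sqrt_iter_sym. vec. }
  exists (fun b => b ⊖ Z b). split; [split|split].
  - apply sym_sum; [apply sym_id|now apply sym_neg].
  - exists 1. split; [lra|]. intros b. replace (1 • b ⊖ (b ⊖ Z b)) with (Z b) by vec. apply BZ.
  - intros b. rewrite (sym_add Z), (sym_opp Z) by exact SZ.
    replace (X b) with (2 • Z b ⊖ Z (Z b)) by (rewrite (EZ b) at 1; vec). vec.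
  - intros T HT CT b. rewrite (proj1 HT), blin_opp by exact HT. f_equal. f_equal.
    assert (CI : forall n, comm T (sqrt_iter n)).
    { induction n as [|n IH]; intros c; simpl.
      - destruct HT as [_ [H _]]. now rewrite <- (rs_0 cs_zero), H, !rs_0.
      - destruct HT as [HA [H _]]. now rewrite H, HA, CT, !IH. }
    apply (conv_unique (fun n => T (sqrt_iter n b))).
    + now apply (conv_blin T (fun n => sqrt_iter n b)).
    + replace (fun n => T (sqrt_iter n b)) with (fun n => sqrt_iter n (T b)); [apply HZ|].
      apply functional_extensionality. intros n. symmetry. apply CI.
Qed.

End SquareRoot.

(** * Norm monotonicity and positivity of [a^* a] *)

Section Positivity.
Context {A : CStarAlgebra}.
Implicit Types (x y z a b c w : A) (S T K H : A -> A).

(** The bound in [psd T] says that [X = 1 - T / t] has norm at most [1]; a root of [1 - X = T / t]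
    times [sqrt t] is a root of [T]. *)
Lemma psd_sqrt T : psd T -> exists Y, psd Y /\ (forall b, Y (Y b) = T b) /\
  (forall S, blin S -> comm S T -> comm S Y).
Proof.
  intros [ST [t [Ht BT]]].
  destruct (sqrt_one_minus (fun b => b ⊖ (/ t) • T b)) as [Y [[SY [s [Hs BY]]] [EY CY]]].
  - apply sym_sum; [apply sym_id|]. now apply sym_neg, sym_scal.
  - intros b. replace (b ⊖ (/ t) • T b) with ((/ t) • (t • b ⊖ T b)) by vec.
    rewrite norm_rs_pos by (left; now apply Rinv_0_lt_compat).
    apply Rmult_le_reg_l with t; [exact Ht|]. rewrite <- Rmult_assoc, Rinv_r by lra.
    specialize (BT b); simpl in BT. lra.
  - pose proof (sqrt_lt_R0 t Ht) as Hr. exists (fun b => sqrt t • Y b). split; [split|split].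
    + now apply sym_scal.
    + exists (sqrt t * s). split; [now apply Rmult_lt_0_compat|]. intros b.
      replace ((sqrt t * s) • b ⊖ sqrt t • Y b) with (sqrt t • (s • b ⊖ Y b)) by vec.
      rewrite norm_rs_pos, Rmult_assoc by lra. apply Rmult_le_compat_l; [lra|apply BY].
    + intros b. rewrite (sym_rs Y), rs_rs, EY, sqrt_sqrt by (trivial; lra). vec.
    + intros S HS CS b. rewrite (proj1 (proj2 HS)). f_equal. apply CY; [exact HS|].
      intros c. rewrite (proj1 HS), blin_opp, (proj1 (proj2 HS)), CS by exact HS. reflexivity.
Qed.

(** After scaling [K] to a contraction [L = K / r], let [Y] be the root of [1 - L^2]. As
    [Y^2 + L^2 = 1], [sum_squares_bd] gives [‖Y‖ <= 1], so [r^2 - K^2 = r^2 Y^2] has norm at most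
    [r^2]. *)
Lemma psd_square K m : sym K -> bd K m -> psd (fun b => K (K b)).
Proof.
  intros SK BK0. set (r := Rabs m + 1).
  assert (Hr : 0 < r) by (unfold r; pose proof (Rabs_pos m); lra).
  assert (BK : bd K r).
  { apply (bd_weaken _ m); [unfold r; pose proof (Rle_abs m); lra|exact BK0]. }
  clear BK0. set (L := fun b => (/ r) • K b).
  assert (SL : sym L) by now apply sym_scal.
  assert (BL : bd L 1).
  { intros b. unfold L. rewrite norm_rs_pos by (left; now apply Rinv_0_lt_compat).
    apply Rmult_le_reg_l with r; [exact Hr|]. rewrite <- Rmult_assoc, Rinv_r by lra.
    specialize (BK b). lra. }
  assert (CL : comm L L) by (intros b; reflexivity).
  destruct (sqrt_one_minus (fun b => L (L b))) as [Y [PY [EY CY]]].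
  { now apply sym_comp. }
  { intros b. pose proof (bd_comp L L 1 1 ltac:(lra) BL BL b). simpl in *. lra. }
  assert (BY : bd Y 1).
  { apply (sum_squares_bd Y L); [lra|apply PY|exact SL| |].
    - intros b. symmetry. apply CY; [now apply sym_blin with 1|]. intros c. reflexivity.
    - intros b. rewrite EY. vec. }
  split; [apply sym_comp; trivial; now intros b|].
  exists (r * r). split; [nra|]. intros b.
  replace ((r * r) • b ⊖ K (K b)) with ((r * r) • Y (Y b)).
  2:{ rewrite EY. unfold L. rewrite (sym_rs K) by exact SK. vec. }
  rewrite norm_rs_pos by nra. apply Rmult_le_compat_l; [nra|].
  pose proof (bd_comp Y Y 1 1 ltac:(lra) BY BY b). simpl in *. lra.
Qed.

(* With [R = M - H] both [H] and [R] are positive and commute, so [(√H)^2 + (√R)^2 = M]. *)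
Lemma psd_bd_summand H K M : 0 < M -> psd H -> psd K -> bd (fun b => H b ⊕ K b) M -> bd H M.
Proof.
  intros HM PH PK B.
  assert (PR : psd (fun b => M • b ⊖ H b)).
  (* The bound on [H + K] is the positivity condition for [M - (H + K)] with [t = M]; adding [K]
     gives [M - H]. *)
  { apply (psd_ext (fun b => (M • b ⊖ (H b ⊕ K b)) ⊕ K b)); [intros b; vec|].
    apply psd_add; [|exact PK]. split.
    - apply sym_sum; [apply sym_scal, sym_id|]. now apply sym_neg, sym_sum; apply psd_sym.
    - exists M. split; [exact HM|]. intros b.
      replace (M • b ⊖ (M • b ⊖ (H b ⊕ K b))) with (H b ⊕ K b) by vec. apply B. }
  destruct (psd_sqrt H PH) as [U [PU [EU CU]]].
  destruct (psd_sqrt _ PR) as [V [PV [EV CV]]].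
  assert (CHU : comm U H).
  { intros b. symmetry. apply CU; [now apply psd_blin|]. intros c; reflexivity. }
  assert (CUV : comm U V).
  { apply CV; [now apply psd_blin|]. intros b. pose proof (psd_blin U PU) as BU.
    now rewrite (proj1 BU), blin_opp, (proj1 (proj2 BU)), CHU. }
  pose proof (sqrt_pos M) as Hs.
  assert (BU : bd U (sqrt M)).
  { apply (sum_squares_bd U V); trivial; [now apply psd_sym|now apply psd_sym|].
    intros b. rewrite EU, EV, sqrt_sqrt by (trivial; lra). vec. }
  intros b. rewrite <- EU. pose proof (bd_comp U U _ _ Hs BU BU b) as L.
  now rewrite sqrt_sqrt in L by lra.
Qed.

(** Positivity is read off left multiplication, since the operators on [A] include the identity even
    when [A] has no unit. *)
Definition pos a : Prop := psd (cs_mul a).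

Lemma sym_mull a : a^* = a -> sym (cs_mul a).
Proof. intros E b c. now rewrite cs_starM, E, cs_mulA. Qed.

Lemma bd_mull a : bd (cs_mul a) (‖a‖).
Proof. intros b. apply cs_normM. Qed.

(** Evaluating at [a^*] gives [‖a‖^2 <= M ‖a‖]. *)
Lemma norm_le_bd a M : 0 <= M -> bd (cs_mul a) M -> ‖a‖ <= M.
Proof.
  intros HM B. specialize (B (a^*)). pose proof (cs_Cstar _ (a^*)) as E.
  rewrite cs_starK in E. rewrite E, norm_star in B. pose proof (norm_ge0 a).
  destruct (Req_dec (‖a‖) 0); [lra|]. apply Rmult_le_reg_r with (‖a‖); lra.
Qed.

Lemma pos_add a b : pos a -> pos b -> pos (a ⊕ b).
Proof.
  intros Ha Hb. apply (psd_ext (fun c => a ⊙ c ⊕ b ⊙ c)); [intros c; now rewrite cs_mulDl|].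
  now apply psd_add.
Qed.

Lemma pos_zero : pos (cs_zero : A).
Proof.
  split; [apply sym_mull, star0|]. exists 1. split; [lra|]. intros b.
  rewrite mul0l. replace (1 • b ⊖ cs_zero) with b by vec. lra.
Qed.

Lemma pos_square a : a^* = a -> pos (a ⊙ a).
Proof.
  intros E. apply (psd_ext (fun b => a ⊙ (a ⊙ b))); [intros b; apply cs_mulA|].
  apply (psd_square (cs_mul a) (‖a‖)); [now apply sym_mull|apply bd_mull].
Qed.

Lemma pos_norm_le_add a b : pos a -> pos b -> ‖a‖ <= ‖a ⊕ b‖.
Proof.
  (* [psd_bd_summand] asks for a positive bound while [‖a ⊕ b‖] may be [0], hence the [eps]. *)
  intros Ha Hb. apply le_epsilon. intros eps He. pose proof (norm_ge0 (a ⊕ b)).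
  apply norm_le_bd; [lra|]. apply (psd_bd_summand _ (cs_mul b)); trivial; [lra|].
  intros c. rewrite <- cs_mulDl. eapply Rle_trans; [apply cs_normM|].
  apply Rmult_le_compat_r; [apply norm_ge0|lra].
Qed.

(* With [M = √(-u)], [u = y*y], [v = yy*] and [w = M y*], both [w*w = -v^2] and [ww* = -u^2]
   are negative, while [2(ww* + w*w)] is a sum of squares of self-adjoint elements. *)
Lemma neg_star_mul_eq0 y : psd (fun b => ⊖ ((y^* ⊙ y) ⊙ b)) -> y = cs_zero.
Proof.
  intros P. destruct (psd_sqrt _ P) as [M [PM [EM _]]]. pose proof (psd_sym _ PM) as SM.
  set (w := M (y^*)). set (u := y^* ⊙ y). set (v := y ⊙ y^*).
  assert (E1 : w^* ⊙ w = ⊖ (v ⊙ v)).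
  { unfold w. rewrite SM, EM. unfold v. autorewrite with cstar. reflexivity. }
  assert (E2 : w ⊙ w^* = ⊖ (u ⊙ u)).
  (* Applied to [c], the left side is [M (u (M c))], and [u M c = - M^3 c] turns it into
     [- M^4 c = - u^2 c]. *)
  { apply mul_cancelr. intros c. rewrite <- cs_mulA. unfold w at 2. rewrite SM, cs_starK.
    unfold w. rewrite <- sym_mul by exact SM. rewrite cs_mulA. fold u.
    replace (u ⊙ M c) with (⊖ M (M (M c))) by (rewrite EM; unfold u; vec).
    rewrite (sym_opp M) by exact SM. rewrite !EM, !mulNr. unfold u.
    autorewrite with cstar. vec. }
  set (p := w ⊕ w^*). set (q := ci (w ⊖ w^*)).
  assert (Hu : pos (u ⊙ u)) by (apply pos_square; unfold u; now autorewrite with cstar).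
  assert (Hv : pos (v ⊙ v)) by (apply pos_square; unfold v; now autorewrite with cstar).
  assert (Hp : pos (p ⊙ p)).
  { apply pos_square. unfold p. autorewrite with cstar. apply cs_addC. }
  assert (Hq : pos (q ⊙ q)).
  { apply pos_square. unfold q. autorewrite with cstar. vec. }
  assert (E : u ⊙ u ⊕ (u ⊙ u ⊕ (v ⊙ v ⊕ (v ⊙ v ⊕ (p ⊙ p ⊕ q ⊙ q)))) = cs_zero).
  { replace (p ⊙ p ⊕ q ⊙ q) with (2 • (w^* ⊙ w) ⊕ 2 • (w ⊙ w^*)).
    - rewrite E1, E2. vec.
    - unfold p, q. autorewrite with cstar. vec. }
  (* By monotonicity of the norm, a vanishing sum of positive elements has vanishing summands. *)
  assert (Z : u ⊙ u = cs_zero).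
  { apply cs_norm_eq0, Rle_antisym; [|apply norm_ge0]. rewrite <- (@norm0 A), <- E at 1.
    apply pos_norm_le_add; auto using pos_add. }
  apply Cstar_eq0. change (u = cs_zero). apply Cstar_eq0.
  replace (u^*) with u by (unfold u; now autorewrite with cstar). exact Z.
Qed.

(* For [N = |H|] and [c = N - H], the element [y = (c a^* )^*] satisfies [y*y = cHc = -Nc^2]. *)
Lemma pos_star_mul a : pos (a^* ⊙ a).
Proof.
  set (h := a^* ⊙ a).
  assert (Hh : h^* = h) by (unfold h; now autorewrite with cstar).
  set (H := cs_mul h). assert (SH : sym H) by now apply sym_mull.
  assert (BH : blin H) by (apply (sym_blin _ (‖h‖)); trivial; apply bd_mull).
  destruct (psd_sqrt (fun b => H (H b))) as [N [PN [EN CN]]].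
  { apply (psd_square H (‖h‖)); trivial. apply bd_mull. }
  assert (SN : sym N) by now apply psd_sym.
  assert (HN : comm H N) by (apply CN; trivial; now intros b).
  destruct (psd_sqrt N PN) as [Q [PQ [EQ CQ]]].
  set (c := fun b => N b ⊖ H b).
  assert (SC : sym c) by (apply sym_sum; trivial; now apply sym_neg).
  destruct (psd_bd N PN) as [n [Hn BN]].
  destruct (psd_bd Q PQ) as [q [Hq BQ]].
  assert (BC : bd c (n + ‖h‖)).
  { intros b. eapply Rle_trans; [apply normB|]. specialize (BN b).
    pose proof (bd_mull h b). unfold H. lra. }
  assert (CC : comm c Q).
  { apply CQ; [now apply sym_blin with (n + ‖h‖)|]. intros b. unfold c.
    now rewrite (sym_add N), (sym_opp N), HN by exact SN. }
  (* From [N^2 = H^2] and commutation, [H c = - N c], so [c H c = - N c^2 = - (Q c)^2]. *)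
  assert (E1 : forall b, c (H (c b)) = ⊖ Q (c (Q (c b)))).
  { intros b. rewrite <- CC, EQ. unfold c.
    repeat rewrite ?(sym_add N), ?(sym_opp N), ?(sym_add H), ?(sym_opp H) by assumption.
    repeat rewrite ?HN, <- ?EN. vec. }
  set (y := (c (a^*))^*).
  assert (Y0 : y = cs_zero).
  { apply neg_star_mul_eq0. apply (psd_ext (fun b => Q (c (Q (c b))))).
    - intros b. unfold y. rewrite cs_starK, <- cs_mulA, SC, cs_starK, <- (sym_mul c) by exact SC.
      rewrite cs_mulA. fold h. fold (H (c b)). rewrite E1. vec.
    - apply (psd_square (fun b => Q (c b)) (q * (n + ‖h‖))).
      + apply sym_comp; trivial; [now apply psd_sym|]. intros b. symmetry. apply CC.
      + now apply bd_comp. }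
  assert (CH : forall b, c (H b) = cs_zero).
  { intros b. unfold H, h. rewrite <- cs_mulA, (sym_mul c) by exact SC.
    rewrite <- (cs_starK _ (c (a^*))). fold y. now rewrite Y0, star0, mul0l. }
  assert (C0 : forall b, c b = cs_zero).
  { intros b. apply Cstar_eq0. rewrite SC.
    (* [c^2 = N^2 - 2 N H + H^2 = 2 H^2 - 2 N H = - 2 c H]. *)
    replace (c (c b)) with ((-2) • c (H b)); [now rewrite CH, rs_zero, mul0r|].
    unfold c. rewrite (sym_add N), (sym_opp N), (sym_add H), (sym_opp H) by assumption.
    repeat rewrite ?HN, <- ?EN. vec. }
  apply (psd_ext N); [|exact PN]. intros b. apply sub_eq0, C0.
Qed.

End Positivity.

(* If [‖a‖ <= 1] then [1 - a*a = Y^2] and [|c|^2 = |ac|^2 + |Yc|^2] for [c = a^*], where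
   [|x|^2 = x*x]; applying [phi] gives [‖phi (ac)‖ <= ‖phi c‖]. *)
Lemma star_hom_contractive (A : CStarAlgebra) (phi : A -> A) (a : A) :
  (forall x y, phi (x ⊕ y) = phi x ⊕ phi y) ->
  (forall t x, phi (cs_scal t x) = cs_scal t (phi x)) ->
  (forall x y, phi (x ⊙ y) = phi x ⊙ phi y) ->
  (forall x, phi (x^*) = (phi x)^*) ->
  ‖phi a‖ <= ‖a‖.
Proof.
  intros HA HZ HM HS.
  assert (C : forall a, ‖a‖ <= 1 -> ‖phi a‖ <= 1).
  { clear a. intros a Ha. pose proof (norm_ge0 a).
    destruct (sqrt_one_minus (cs_mul (a^* ⊙ a))) as [Y [PY [EY _]]].
    - apply sym_mull. now autorewrite with cstar.
    - intros b. eapply Rle_trans; [apply cs_normM|].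
      apply Rmult_le_compat_r; [apply norm_ge0|]. rewrite cs_Cstar. nra.
    - set (c := a^*). pose proof (psd_sym _ PY) as SY.
      assert (E : (a ⊙ c)^* ⊙ (a ⊙ c) ⊕ (Y c)^* ⊙ Y c = c^* ⊙ c).
      { rewrite SY, EY. autorewrite with cstar. vec. }
      apply (f_equal phi) in E. rewrite HA, !HM, !HS, <- HM in E.
      (* As [a c = a a^*], the resulting inequality reads [‖phi a‖^4 <= ‖phi a‖^2]. *)
      pose proof (pos_norm_le_add _ _ (pos_star_mul (phi (a ⊙ c)))
        (pos_star_mul (phi (Y c)))) as L.
      rewrite E, !cs_Cstar in L. rewrite HM in L. unfold c in L. rewrite HS in L.
      rewrite <- (cs_starK _ (phi a)) in L at 1 3. rewrite cs_Cstar, norm_star in L.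
      pose proof (norm_ge0 (phi a)). destruct (Rle_lt_dec (‖phi a‖) 1) as [|G]; [trivial|].
      exfalso. assert (1 < ‖phi a‖ * ‖phi a‖) by nra. nra. }
  pose proof (norm_ge0 a). destruct (Req_dec (‖a‖) 0) as [Z|Z].
  - apply cs_norm_eq0 in Z. rewrite Z, <- (scal_C0 cs_zero), HZ, !scal_C0. lra.
  - assert (Hi : 0 < / ‖a‖) by (apply Rinv_0_lt_compat; lra).
    assert (L : ‖phi ((/ ‖a‖) • a)‖ <= 1).
    { apply C. rewrite norm_rs_pos, Rinv_l by lra. lra. }
    unfold rs in L. rewrite HZ in L. fold (rs (/ ‖a‖) (phi a)) in L.
    rewrite norm_rs_pos in L by lra. apply (Rmult_le_compat_l (‖a‖)) in L; [|lra].
    rewrite <- Rmult_assoc, Rinv_r in L by lra. lra.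
Qed.

(** * Finite groups and sums over them *)

Section Groups.
Context {G : FinGroup}.
Implicit Types g h k : G.

Lemma fg_mulKl g h : fg_mul (fg_inv g) (fg_mul g h) = h.
Proof. now rewrite fg_mulA, fg_mulV, fg_mul1. Qed.

Lemma fg_cancell g h k : fg_mul g h = fg_mul g k -> h = k.
Proof. intros E. now rewrite <- (fg_mulKl g h), E, fg_mulKl. Qed.

Lemma fg_mul1r g : fg_mul g fg_one = g.
Proof. apply (fg_cancell (fg_inv g)). now rewrite fg_mulKl, fg_mulV. Qed.

Lemma fg_mulVr g : fg_mul g (fg_inv g) = fg_one.
Proof. apply (fg_cancell (fg_inv g)). now rewrite fg_mulKl, fg_mul1r. Qed.

Lemma fg_mulKr g h : fg_mul g (fg_mul (fg_inv g) h) = h.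
Proof. now rewrite fg_mulA, fg_mulVr, fg_mul1. Qed.

Lemma fg_inv1 : fg_inv (fg_one : G) = fg_one.
Proof. now rewrite <- (fg_mul1r (fg_inv fg_one)), fg_mulV. Qed.

Lemma fg_cancelr g h k : fg_mul h g = fg_mul k g -> h = k.
Proof.
  intros E. now rewrite <- (fg_mul1r h), <- (fg_mul1r k), <- (fg_mulVr g), !fg_mulA, E.
Qed.

End Groups.

Section FiniteSums.
Context {A : CStarAlgebra} {J : Type}.
Implicit Types (f g : J -> A) (l : list J).

(** Convertible to [gsum] on the list [fg_enum G]; a variable list allows induction. *)
Definition fsum l f : A := fold_right (fun i acc => f i ⊕ acc) cs_zero l.

Lemma fsum_ext l f g : (forall i, f i = g i) -> fsum l f = fsum l g.
Proof. intros E. induction l as [|i l IH]; simpl; [reflexivity|]. now rewrite E, IH. Qed.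

Lemma fsum_zero l f : (forall i, In i l -> f i = cs_zero) -> fsum l f = cs_zero.
Proof.
  intros E. induction l as [|i l IH]; simpl; [reflexivity|].
  rewrite E, IH, cs_add0; auto using in_eq, in_cons.
Qed.

Lemma fsum_single l f i : NoDup l -> In i l -> (forall j, j <> i -> f j = cs_zero) ->
  fsum l f = f i.
Proof.
  intros ND Hi E. induction ND as [|j l Hj ND IH]; [destruct Hi|]. simpl.
  destruct Hi as [->|Hi].
  - rewrite fsum_zero, cs_add0; [reflexivity|]. intros k Hk. apply E. now intros ->.
  - rewrite IH, E, add0l by trivial || (now intros ->). reflexivity.
Qed.

Lemma fsum_sub l f g : fsum l f ⊖ fsum l g = fsum l (fun i => f i ⊖ g i).
Proof.
  induction l as [|i l IH]; simpl; [apply cs_addN|]. rewrite <- IH. vec.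
Qed.

Lemma fsum_mull l f c : c ⊙ fsum l f = fsum l (fun i => c ⊙ f i).
Proof. induction l as [|i l IH]; simpl; [apply mul0r|]. now rewrite cs_mulDr, IH. Qed.

Lemma fsum_mulr l f c : fsum l f ⊙ c = fsum l (fun i => f i ⊙ c).
Proof. induction l as [|i l IH]; simpl; [apply mul0l|]. now rewrite cs_mulDl, IH. Qed.

Lemma fsum_star l f : (fsum l f)^* = fsum l (fun i => (f i)^*).
Proof. induction l as [|i l IH]; simpl; [apply star0|]. now rewrite cs_starD, IH. Qed.

Lemma fsum_norm l f M : (forall i, ‖f i‖ <= M) -> ‖fsum l f‖ <= INR (length l) * M.
Proof.
  intros B. induction l as [|i l IH]; [simpl; rewrite norm0; lra|].
  change (length (i :: l)) with (S (length l)). rewrite S_INR. simpl.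
  pose proof (cs_norm_triangle _ (f i) (fsum l f)). specialize (B i). lra.
Qed.

Lemma fsum_pos l f : (forall i, pos (f i)) -> pos (fsum l f).
Proof. intros P. induction l as [|i l IH]; simpl; [apply pos_zero|]. now apply pos_add. Qed.

Lemma fsum_pos_norm l f i : (forall i, pos (f i)) -> In i l -> ‖f i‖ <= ‖fsum l f‖.
Proof.
  intros P. induction l as [|j l IH]; intros Hi; [destruct Hi|]. simpl.
  destruct Hi as [->|Hi]; [apply pos_norm_le_add; auto using fsum_pos|].
  eapply Rle_trans; [now apply IH|]. rewrite cs_addC.
  apply pos_norm_le_add; auto using fsum_pos.
Qed.

Lemma norms_bounded l f : exists M, 0 <= M /\ forall i, In i l -> ‖f i‖ <= M.
Proof.
  induction l as [|j l [M [HM B]]]; [exists 0; split; [lra|intros i []]|].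
  exists (M + ‖f j‖). pose proof (norm_ge0 (f j)). split; [lra|].
  intros i [->|Hi]; [lra|]. specialize (B i Hi). lra.
Qed.

End FiniteSums.

Lemma lsum_ext {T : Type} (z : T) add n f g : (forall i, (i < n)%nat -> f i = g i) ->
  lsum z add n f = lsum z add n g.
Proof.
  intros E. induction n as [|n IH]; simpl; [reflexivity|].
  rewrite IH, E by (intros; try apply E; lia). reflexivity.
Qed.

(** * The crossed product *)

Section CrossedProductIdeals.
Context {A : CStarAlgebra} {G : FinGroup} {alpha : G -> A -> A}.
Hypothesis Hact : is_action G A alpha.
Implicit Types (a b : A) (f xi : G -> A) (g h k : G).

Let card := INR (length (fg_enum G)).

Lemma act_one a : alpha fg_one a = a.
Proof. apply Hact. Qed.

Lemma act_zero g : alpha g cs_zero = cs_zero.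
Proof.
  destruct (proj1 Hact g) as [_ [HZ _]].
  now rewrite <- (scal_C0 cs_zero), HZ, !scal_C0.
Qed.

Lemma act_norm g a : ‖alpha g a‖ <= ‖a‖.
Proof.
  destruct (proj1 Hact g) as [HA [HZ [HM [HS _]]]]. now apply star_hom_contractive.
Qed.

Lemma act_surj g b : exists a, alpha g a = b.
Proof. destruct (proj1 Hact g) as [_ [_ [_ [_ [psi [_ H]]]]]]. now exists (psi b). Qed.

(** The element [a u_g] of the crossed product, with equality in [G] decided classically. *)
Definition dirac g a : G -> A :=
  fun k => if excluded_middle_informative (k = g) then a else cs_zero.

Lemma dirac_eq g a : dirac g a g = a.
Proof. unfold dirac. now destruct excluded_middle_informative. Qed.

Lemma dirac_neq g k a : k <> g -> dirac g a k = cs_zero.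
Proof. unfold dirac. now destruct excluded_middle_informative. Qed.

Lemma gsum_single (F : G -> A) g : (forall k, k <> g -> F k = cs_zero) -> gsum F = F g.
Proof. apply fsum_single; [apply fg_enum_nodup|apply fg_enum_all]. Qed.

Lemma cp_mul_diracl g a f k :
  cp_mul G A alpha (dirac g a) f k = a ⊙ alpha g (f (fg_mul (fg_inv g) k)).
Proof.
  unfold cp_mul. rewrite gsum_single with (g := g); [now rewrite dirac_eq|].
  intros h Hh. now rewrite dirac_neq, mul0l.
Qed.

Lemma cp_mul_dirac g h a b :
  cp_mul G A alpha (dirac g a) (dirac h b) = dirac (fg_mul g h) (a ⊙ alpha g b).
Proof.
  apply functional_extensionality. intros k. rewrite cp_mul_diracl.
  destruct (classic (k = fg_mul g h)) as [->|N].
  - now rewrite fg_mulKl, !dirac_eq.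
  - rewrite !dirac_neq; [now rewrite act_zero, mul0r|exact N|].
    intros E. apply N. now rewrite <- E, fg_mulKr.
Qed.

Lemma cp_mul_dirac1r f b k :
  cp_mul G A alpha f (dirac fg_one b) k = f k ⊙ alpha k b.
Proof.
  unfold cp_mul. rewrite gsum_single with (g := k).
  - now rewrite fg_mulV, dirac_eq.
  - intros h Hh. rewrite dirac_neq; [now rewrite act_zero, mul0r|].
    intros E. apply Hh. symmetry. now rewrite <- (fg_mul1r h), <- E, fg_mulKr.
Qed.

(** Each [xi(g)^* xi(g)] is a positive summand of the inner product, so monotonicity of the norm
    applies. *)
Lemma l2_ball_norm xi g : ‖l2_inner G A xi xi‖ <= 1 -> ‖xi g‖ <= 1.
Proof.
  intros B. pose proof (fsum_pos_norm (fg_enum G) (fun g => (xi g)^* ⊙ xi g) g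
    (fun g => pos_star_mul (xi g)) (fg_enum_all G g)) as L.
  simpl in L. rewrite cs_Cstar in L. unfold l2_inner, gsum in B.
  fold (fsum (fg_enum G) (fun g => (xi g)^* ⊙ xi g)) in B.
  pose proof (norm_ge0 (xi g)). nra.
Qed.

Lemma regrep_norm d xi M : 0 <= M -> (forall g, ‖d g‖ <= M) -> ‖l2_inner G A xi xi‖ <= 1 ->
  ‖l2_inner G A (regrep G A alpha d xi) (regrep G A alpha d xi)‖
  <= card * ((card * M) * (card * M)).
Proof.
  intros HM B Hxi. apply fsum_norm. intros g.
  assert (L : ‖regrep G A alpha d xi g‖ <= card * M).
  { apply fsum_norm. intros k. rewrite <- (Rmult_1_r M). apply norm_mul_le.
    - eapply Rle_trans; [apply act_norm|apply B].
    - now apply l2_ball_norm. }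
  apply norm_mul_le; [now rewrite norm_star|exact L].
Qed.

Lemma card_ge0 : 0 <= card.
Proof. apply pos_INR. Qed.

(** Transfers approximation of coefficients to the C*-norm, the topology in which ideals are assumed
    closed. *)
Lemma cp_conv_uniform (s : nat -> G -> A) l :
  (forall n g, ‖s n g ⊖ l g‖ <= / INR (S n)) -> cp_conv G A alpha s l.
Proof.
  intros B eps He. pose proof card_ge0 as Hc.
  set (q := card * (card * card)). assert (Hq : 0 <= q) by (unfold q; nra).
  (* [cp_conv] bounds the square of the norm, here by [q t^2] with [t = 1 / (n + 1)]. Since [t <= 1]
     this is at most [q t]; the [1] in [q + 1] keeps the divisor positive. *)
  destruct (archimed_cor1 (eps / (q + 1))) as [N [HN HN0]]; [apply Rdiv_lt_0_compat; lra|].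
  exists N. intros n Hn xi Hxi d. eapply Rle_trans.
  - apply regrep_norm with (M := / INR (S n)); [|intros g|exact Hxi].
    + left. apply Rinv_0_lt_compat, lt_0_INR. lia.
    + unfold d, cp_add, cp_scal. eapply Rle_trans; [|apply (B n g)]. right. f_equal. vec.
  - assert (HS : 0 < INR N) by (apply lt_0_INR; lia).
    assert (HL : INR N <= INR (S n)) by (apply le_INR; lia).
    assert (H1 : 1 <= INR (S n)) by (change 1 with (INR 1); apply le_INR; lia).
    pose proof (Rinv_0_lt_compat (INR (S n)) ltac:(lra)) as HI.
    pose proof (Rinv_le_contravar _ _ HS HL) as HI2.
    assert (HI3 : / INR (S n) <= 1) by (rewrite <- Rinv_1; apply Rinv_le_contravar; lra).
    apply (Rmult_lt_compat_l (q + 1)) in HN; [|lra].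
    replace ((q + 1) * (eps / (q + 1))) with eps in HN by (field; lra).
    set (t := / INR (S n)) in *.
    replace (card * (card * t * (card * t))) with (q * (t * t)) by (unfold q; ring).
    assert (t * t <= / INR N) by nra. nra.
Qed.

(** * Closed ideals of the crossed product *)

Section ClosedIdeal.
Variable I : (G -> A) -> Prop.
Hypotheses (I0 : I (cp_zero G A))
  (IA : forall x y, I x -> I y -> I (cp_add G A x y))
  (IS : forall t x, I x -> I (cp_scal G A t x))
  (IM : forall y x, I x -> I (cp_mul G A alpha y x) /\ I (cp_mul G A alpha x y))
  (IC : forall s l, (forall n : nat, I (s n)) -> cp_conv G A alpha s l -> I l).
Hypothesis HR : rokhlin_property G A alpha.

Lemma ideal_uniform_limit l :
  (forall eps, 0 < eps -> exists x, I x /\ forall g, ‖x g ⊖ l g‖ <= eps) -> I l.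
Proof.
  intros H.
  assert (C : forall n, exists x, I x /\ forall g, ‖x g ⊖ l g‖ <= / INR (S n)).
  { intros n. apply H. apply Rinv_0_lt_compat, lt_0_INR. lia. }
  apply (IC (fun n => proj1_sig (constructive_indefinite_description _ (C n)))).
  - intros n. now destruct constructive_indefinite_description as [x []].
  - apply cp_conv_uniform. intros n. now destruct constructive_indefinite_description as [x []].
Qed.

Definition cp_fsum {J : Type} (l : list J) (F : J -> G -> A) : G -> A :=
  fold_right (fun i acc => cp_add G A (F i) acc) (cp_zero G A) l.

Lemma cp_fsumE {J : Type} (l : list J) F k : cp_fsum l F k = fsum l (fun i => F i k).
Proof.
  induction l as [|i l IH]; simpl; [reflexivity|]. unfold cp_add at 1. now rewrite IH.
Qed.

Lemma ideal_cp_fsum {J : Type} (l : list J) F : (forall i, I (F i)) -> I (cp_fsum l F).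
Proof. intros H. induction l as [|i l IH]; simpl; auto. Qed.

(* [Σ_g r_g f r_(h^-1 g)] approximates [f(h) u_h]: its coefficient at [k] is close to
   [f(k) Σ_g r_g r_(k h^-1 g)], which vanishes for [k <> h] by orthogonality. *)
Lemma ideal_component f h : I f -> I (dirac h (f h)).
Proof.
  intros Hf. apply ideal_uniform_limit. intros eps0 He0.
  destruct (norms_bounded (fg_enum G) f) as [M [HM B]].
  pose proof card_ge0 as Hc.
  (* The first summand collects the errors of commuting [r_g] past [f(k)] and of replacing [alpha_k]
     of a tower element by its translate; the second comes from using [e] twice as an approximate
     unit. *)
  set (D := card * (1 + M) + (card + 1)).
  assert (HD : 0 < D) by (unfold D; nra).
  set (eps := eps0 / D). assert (He : 0 < eps) by now apply Rdiv_lt_0_compat.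
  assert (HeD : eps * D = eps0) by (unfold eps; field; lra).
  (* The tower sum nearly fixes elements from the left, whereas [f(h) e] is to be close to [f(h)];
     taking stars, [f(h)^*] is put in the list. *)
  destruct (HR eps He ((f h)^* :: map f (fg_enum G))) as [r [RP [RO [RE [RC RU]]]]].
  assert (Rstar : forall g, (r g)^* = r g).
  { intros g. destruct (RP g) as [[y ->] _]. now autorewrite with cstar. }
  assert (RN : forall g, ‖r g‖ <= 1) by (intros g; apply RP).
  set (e := gsum r). assert (Estar : e^* = e).
  { unfold e, gsum. fold (fsum (fg_enum G) r). rewrite fsum_star. now apply fsum_ext. }
  assert (EN : ‖e‖ <= card) by (rewrite <- (Rmult_1_r card); now apply fsum_norm).
  exists (cp_fsum (fg_enum G) (fun g =>
    cp_mul G A alpha (cp_mul G A alpha (dirac fg_one (r g)) f)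
      (dirac fg_one (r (fg_mul (fg_inv h) g))))).
  split; [apply ideal_cp_fsum; intros g; exact (proj2 (IM _ _ (proj1 (IM _ _ Hf))))|].
  intros k. rewrite cp_fsumE.
  set (T := fun g => f k ⊙ (r g ⊙ r (fg_mul k (fg_mul (fg_inv h) g)))).
  assert (L1 : ‖fsum (fg_enum G) (fun g => cp_mul G A alpha
      (cp_mul G A alpha (dirac fg_one (r g)) f) (dirac fg_one (r (fg_mul (fg_inv h) g))) k)
    ⊖ fsum (fg_enum G) T‖ <= card * (eps * 1 + M * (1 * eps))).
  { rewrite fsum_sub. apply fsum_norm. intros g.
    rewrite cp_mul_dirac1r, cp_mul_diracl, act_one, fg_inv1, fg_mul1. unfold T.
    set (r1 := alpha k _). set (r2 := r (fg_mul k _)).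
    replace (r g ⊙ f k ⊙ r1 ⊖ f k ⊙ (r g ⊙ r2)) with
      ((r g ⊙ f k ⊖ f k ⊙ r g) ⊙ r1 ⊕ f k ⊙ (r g ⊙ (r1 ⊖ r2))).
    2:{ autorewrite with cstar. vec. }
    eapply Rle_trans; [apply cs_norm_triangle|].
    apply Rplus_le_compat; repeat apply norm_mul_le; auto.
    - left. apply RC. right. apply in_map, fg_enum_all.
    - eapply Rle_trans; [apply act_norm|apply RN].
    - apply B, fg_enum_all.
    - left. apply RE. }
  assert (L2 : ‖fsum (fg_enum G) T ⊖ dirac h (f h) k‖ <= eps * (card + 1)).
  { destruct (classic (k = h)) as [->|N].
    - rewrite dirac_eq.
      replace (fsum (fg_enum G) T) with (f h ⊙ (e ⊙ e)).
      + assert (L : ‖f h ⊙ e ⊖ f h‖ <= eps).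
        { rewrite <- norm_star. autorewrite with cstar. rewrite Estar. left. apply RU. now left. }
        replace (f h ⊙ (e ⊙ e) ⊖ f h) with ((f h ⊙ e ⊖ f h) ⊙ e ⊕ (f h ⊙ e ⊖ f h)).
        2:{ autorewrite with cstar. vec. }
        eapply Rle_trans; [apply cs_norm_triangle|].
        pose proof (norm_mul_le _ _ _ _ L EN). lra.
      (* For [k = h] the sum of the [r_g^2] equals [e^2] by orthogonality. *)
      + unfold T. rewrite <- fsum_mull. f_equal. unfold e at 1, gsum.
        fold (fsum (fg_enum G) r). rewrite fsum_mulr. apply fsum_ext. intros g.
        rewrite fg_mulKr. unfold e, gsum. fold (fsum (fg_enum G) r). rewrite fsum_mull.
        apply (gsum_single (fun i => r g ⊙ r i)). intros i Hi. apply RO. congruence.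
    (* For [k <> h] one has [k h^-1 g <> g], so every product of tower elements vanishes. *)
    - rewrite dirac_neq, fsum_zero by trivial || (intros g _; unfold T; rewrite RO, mul0r;
        [reflexivity|]; intros E; apply N, (fg_cancelr (fg_mul (fg_inv h) g));
        now rewrite <- E, fg_mulKr).
      rewrite cs_addN, norm0. nra. }
  eapply Rle_trans; [apply norm_dist|]. eapply Rle_trans; [apply Rplus_le_compat; eassumption|].
  right. rewrite <- HeD. unfold D. ring.
Qed.

(** As [u_g] itself may lie outside the crossed product, [a u_1] is multiplied by [e u_g], where [e]
    is the sum of a tower chosen for [a^*], so that [a e] is close to [a]. *)
Lemma ideal_dirac a g : I (dirac fg_one a) -> I (dirac g a).
Proof.
  intros Ha. apply ideal_uniform_limit. intros eps He.
  destruct (HR eps He (a^* :: nil)) as [r [RP [_ [_ [_ RU]]]]].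
  exists (cp_mul G A alpha (dirac fg_one a) (dirac g (gsum r))).
  split; [exact (proj2 (IM _ _ Ha))|].
  intros k. rewrite cp_mul_dirac, act_one, fg_mul1.
  destruct (classic (k = g)) as [->|N].
  - rewrite !dirac_eq, <- norm_star. autorewrite with cstar.
    replace ((gsum r)^*) with (gsum r); [left; apply RU; now left|].
    symmetry. unfold gsum. fold (fsum (fg_enum G) r). rewrite fsum_star. apply fsum_ext.
    intros i. destruct (RP i) as [[y ->] _]. now autorewrite with cstar.
  - rewrite !dirac_neq, cs_addN, norm0 by exact N. lra.
Qed.

(** If [f(h) <> 0] and [alpha_h(b) = f(h)^*], then [f(h) u_h] times [b u_(h^-1)] is
    [f(h) f(h)^* u_1], which is nonzero by the C*-identity. *)
Lemma ideal_meets_coefficients : (exists x, I x /\ x <> cp_zero G A) ->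
  exists a, I (dirac fg_one a) /\ a <> cs_zero.
Proof.
  intros [f [Hf Nf]].
  destruct (not_all_ex_not _ (fun h => f h = cs_zero)) as [h Nh].
  { intros E. apply Nf. now apply functional_extensionality. }
  destruct (act_surj h ((f h)^*)) as [b Hb].
  exists (f h ⊙ (f h)^*). split.
  - rewrite <- Hb, <- (fg_mulVr h), <- cp_mul_dirac.
    now apply (proj2 (IM _ _ (ideal_component f h Hf))).
  - intros E. apply Nh. rewrite <- (cs_starK _ (f h)), (Cstar_eq0 ((f h)^*)), star0; trivial.
    now rewrite cs_starK.
Qed.

End ClosedIdeal.
End CrossedProductIdeals.

(** * Finite codimension in the crossed product *)

Lemma lsum_app {A : CStarAlgebra} n m (F : nat -> A) :
  lsum cs_zero cs_add (n + m) F =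
  lsum cs_zero cs_add n F ⊕ lsum cs_zero cs_add m (fun i => F (n + i)%nat).
Proof.
  induction m as [|m IH]; simpl; [now rewrite Nat.add_0_r, cs_add0|].
  now rewrite Nat.add_succ_r, cs_addA, <- IH.
Qed.

Lemma lsum_cp {A : CStarAlgebra} {G : FinGroup} n (F : nat -> G -> A) k :
  lsum (cp_zero G A) (cp_add G A) n F k = lsum cs_zero cs_add n (fun i => F i k).
Proof. induction n as [|n IH]; simpl; [reflexivity|]. unfold cp_add at 1. now rewrite IH. Qed.

Section Dirac.
Context {A : CStarAlgebra} {G : FinGroup}.
Implicit Types (a b : A) (g k : G).

Lemma dirac_zero g k : dirac g (cs_zero : A) k = cs_zero.
Proof. unfold dirac. now destruct excluded_middle_informative. Qed.

Lemma dirac_add g a b k : dirac g (a ⊕ b) k = dirac g a k ⊕ dirac g b k.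
Proof.
  unfold dirac. destruct excluded_middle_informative; [reflexivity|]. now rewrite cs_add0.
Qed.

Lemma dirac_scal g t a k : dirac g (cs_scal t a) k = cs_scal t (dirac g a k).
Proof.
  unfold dirac. destruct excluded_middle_informative; [reflexivity|].
  rewrite <- (scal_C0 cs_zero), cs_scalA. f_equal. unfold Cmul; simpl; f_equal; ring.
Qed.

Lemma dirac_lsum g n c (v : nat -> A) k :
  dirac g (lsum cs_zero cs_add n (fun i => cs_scal (c i) (v i))) k =
  lsum cs_zero cs_add n (fun i => cs_scal (c i) (dirac g (v i) k)).
Proof.
  induction n as [|n IH]; simpl; [apply dirac_zero|].
  now rewrite dirac_add, dirac_scal, IH.
Qed.

Lemma cp_fsum_dirac (f : G -> A) : cp_fsum (fg_enum G) (fun g => dirac g (f g)) = f.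
Proof.
  apply functional_extensionality. intros k. rewrite cp_fsumE.
  rewrite <- (dirac_eq k (f k)).
  apply (gsum_single (fun g => dirac g (f g) k) k). intros g Hg. now apply dirac_neq, not_eq_sym.
Qed.

(** Each new [g] puts the [n0] vectors [v0_i u_g] in front of the earlier ones, whose indices shift
    by [n0]. On the list [fg_enum G] the sum of the [f(g) u_g] is all of [f]. *)
Lemma finite_codim_cp (I : (G -> A) -> Prop) n0 (v0 : nat -> A) :
  I (cp_zero G A) ->
  (forall x y, I x -> I y -> I (cp_add G A x y)) ->
  (forall a g, I (dirac fg_one a) -> I (dirac g a)) ->
  (forall x, exists c, I (dirac fg_one (cs_add x (cs_scal Cneg1
     (lsum cs_zero cs_add n0 (fun i => cs_scal (c i) (v0 i))))))) ->
  forall l : list G, exists n v, forall f, exists c,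
    I (cp_add G A (cp_fsum l (fun g => dirac g (f g))) (cp_scal G A Cneg1
      (lsum (cp_zero G A) (cp_add G A) n (fun i => cp_scal G A (c i) (v i))))).
Proof.
  intros I0 IA ID HJ l. induction l as [|g l [n [v H]]].
  - exists O, (fun _ => cp_zero G A). intros f. exists (fun _ => Cneg1).
    replace (cp_add _ _ _ _) with (cp_zero G A); [exact I0|].
    apply functional_extensionality. intros k. unfold cp_add, cp_scal; simpl. unfold cp_zero. vec.
  - exists (n0 + n)%nat,
      (fun i => if Nat.ltb i n0 then dirac g (v0 i) else v (i - n0)%nat).
    intros f. destruct (HJ (f g)) as [c0 Hc0]. destruct (H f) as [c Hc].
    exists (fun i => if Nat.ltb i n0 then c0 i else c (i - n0)%nat).
    pose proof (IA _ _ (ID _ g Hc0) Hc) as K.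
    match goal with |- I ?y => match type of K with I ?x => replace y with x; [exact K|] end end.
    apply functional_extensionality. intros k. simpl cp_fsum.
    unfold cp_add at 1 2 4 5, cp_scal at 1 3.
    rewrite !lsum_cp, lsum_app, dirac_add, dirac_scal, dirac_lsum.
    rewrite (lsum_ext cs_zero cs_add n0
      (fun i => cp_scal G A (if Nat.ltb i n0 then c0 i else c (i - n0)%nat)
        (if Nat.ltb i n0 then dirac g (v0 i) else v (i - n0)%nat) k)
      (fun i => cs_scal (c0 i) (dirac g (v0 i) k))).
    2:{ intros i Hi. apply Nat.ltb_lt in Hi. now rewrite Hi. }
    rewrite (lsum_ext cs_zero cs_add n
      (fun i => cp_scal G A (if Nat.ltb (n0 + i) n0 then c0 (n0 + i)%nat
          else c (n0 + i - n0)%nat)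
        (if Nat.ltb (n0 + i) n0 then dirac g (v0 (n0 + i)%nat)
          else v (n0 + i - n0)%nat) k)
      (fun i => cp_scal G A (c i) (v i) k)).
    2:{ intros i Hi. replace (Nat.ltb (n0 + i) n0) with false.
        - now replace (n0 + i - n0)%nat with i by lia.
        - symmetry. apply Nat.ltb_ge. lia. }
    vec.
Qed.

End Dirac.

Theorem theorem2p27 (A : CStarAlgebra) (G : FinGroup) (alpha : G -> A -> A)
  (Hact : is_action G A alpha)
  (HJI : cstar_just_infinite A)
  (HR : rokhlin_property G A alpha) :
  crossed_product_just_infinite G A alpha.
Proof.
  destruct HJI as [Hinf Hquot]. split.
  (* The coefficients at [1] of a finite spanning family would span [A], because [x] is the
     coefficient of [x u_1]. *)
  - intros [n [v H]]. apply Hinf. exists n, (fun i => v i fg_one). intros x.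
    destruct (H (dirac fg_one x)) as [c Hc]. exists c.
    rewrite <- (dirac_eq (fg_one : G) x), Hc, lsum_cp. reflexivity.
  - intros I I0 IA IS IM IC IN.
    assert (Hlim := ideal_uniform_limit Hact I IC).
    assert (ID := fun a g => ideal_dirac Hact I IM IC HR a g).
    (* Six goals check that the [a] with [a u_1] in [I] form a nonzero closed ideal of [A]; the last
       one lifts a finite spanning set of the quotient. *)
    destruct (Hquot (fun a => I (dirac fg_one a))) as [n0 [v0 H0]].
    + replace (dirac _ _) with (cp_zero G A); [exact I0|].
      apply functional_extensionality. intros k. symmetry. apply dirac_zero.
    + intros x y Hx Hy. replace (dirac _ _) with (cp_add G A (dirac fg_one x) (dirac fg_one y));
        [now apply IA|]. apply functional_extensionality. intros k. symmetry. apply dirac_add.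
    + intros t x Hx. replace (dirac _ _) with (cp_scal G A t (dirac fg_one x)); [now apply IS|].
      apply functional_extensionality. intros k. symmetry. apply dirac_scal.
    + intros a x Hx. destruct (IM (dirac fg_one a) _ Hx) as [H1 H2].
      rewrite cp_mul_dirac, (act_one Hact), fg_mul1 in H1, H2 by exact Hact. now split.
    + intros s l Hs Hl. apply Hlim. intros eps He. destruct (Hl eps He) as [N HN].
      exists (dirac fg_one (s N)). split; [apply Hs|]. intros g.
      destruct (classic (g = fg_one)) as [->|Ng].
      * rewrite !dirac_eq. left. now apply HN.
      * rewrite !dirac_neq, cs_addN, norm0 by exact Ng. lra.
    + now apply (ideal_meets_coefficients Hact I I0 IA IM IC HR).
    + destruct (finite_codim_cp I n0 v0 I0 IA ID H0 (fg_enum G)) as [n [v H]].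
      exists n, v. intros f. destruct (H f) as [c Hc]. exists c.
      now rewrite cp_fsum_dirac in Hc.
Qed.
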